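(* Let $L$ be a distributive weakly dicomplemented lattice. The congruences of $L$ generated by filters commute: for any filters $F_1,F_2$ of $L$, if $\Theta(F_i)$ denotes the smallest congruence of $L$ collapsing $F_i$ ($i=1,2$), then $\Theta(F_1)\circ\Theta(F_2)=\Theta(F_2)\circ\Theta(F_1)$.
   Context: A weakly dicomplemented lattice (WDL) is an algebra $(L;\wedge,\vee,{}^{\Delta},{}^{\nabla},0,1)$ of type $(2,2,1,1,0,0)$ such that $(L;\wedge,\vee,0,1)$ is a bounded lattice and for all $x,y\in L$: $x^{\Delta\Delta}\le x$; $x\le y\Rightarrow y^{\Delta}\le x^{\Delta}$; $(x\wedge y)\vee(x\wedge y^{\Delta})=x$; $x^{\nabla\nabla}\ge x$; $x\le y\Rightarrow y^{\nabla}\le x^{\nabla}$; $(x\vee y)\wedge(x\vee y^{\nabla})=x$. It is distributive if its underlying lattice is. Congruences are equivalence relations compatible with $\wedge,\vee,{}^{\Delta},{}^{\nabla}$. A filter is a nonempty upward closed subset closed under $\wedge$. A congruence $\theta$ collapses $F$ if $(x,1)\in\theta$ for all $x\in F$. $\circ$ is the relational product. *)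

(* Defs.v *)
From HB Require Import structures.
From mathcomp Require Import all_boot all_order.
From mathcomp Require Import boolp classical_sets.

Set Implicit Arguments.
Unset Strict Implicit.
Unset Printing Implicit Defensive.

Import Order.TTheory.
Local Open Scope classical_set_scope.
Local Open Scope order_scope.

HB.mixin Record hasWeakDicomplementation d L of Order.TBLattice d L := {
  wdelta : L -> L;
  wnabla : L -> L;
  wdeltaK_le : forall x : L, wdelta (wdelta x) <= x;
  wdelta_anti : forall x y : L, x <= y -> wdelta y <= wdelta x;
  wdelta_split : forall x y : L, (x `&` y) `|` (x `&` wdelta y) = x;
  wnablaK_ge : forall x : L, x <= wnabla (wnabla x);
  wnabla_anti : forall x y : L, x <= y -> wnabla y <= wnabla x;
  wnabla_split : forall x y : L, (x `|` y) `&` (x `|` wnabla y) = x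
}.

#[short(type="wdLatticeType")]
HB.structure Definition WDLattice d :=
  { L of Order.TBLattice d L & hasWeakDicomplementation d L }.

#[short(type="distrWDLatticeType")]
HB.structure Definition DistrWDLattice d :=
  { L of Order.TBDistrLattice d L & hasWeakDicomplementation d L }.

Section WDLatticeTheory.
Context {d : Order.disp_t} {L : wdLatticeType d}.

Record is_filter (F : set L) : Prop := IsFilter {
  filter_nonempty : F !=set0;
  filter_up : forall x y : L, F x -> x <= y -> F y;
  filter_meet : forall x y : L, F x -> F y -> F (x `&` y)
}.

Record is_congruence (th : set (L * L)) : Prop := IsCongruence {
  cong_refl : forall x : L, th (x, x);
  cong_sym : forall x y : L, th (x, y) -> th (y, x);
  cong_trans : forall x y z : L, th (x, y) -> th (y, z) -> th (x, z);
  cong_meet : forall x y x' y' : L,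
    th (x, y) -> th (x', y') -> th (x `&` x', y `&` y');
  cong_join : forall x y x' y' : L,
    th (x, y) -> th (x', y') -> th (x `|` x', y `|` y');
  cong_delta : forall x y : L, th (x, y) -> th (wdelta x, wdelta y);
  cong_nabla : forall x y : L, th (x, y) -> th (wnabla x, wnabla y)
}.

Definition collapses (th : set (L * L)) (F : set L) : Prop :=
  forall x : L, F x -> th (x, \top).

(* [smallest] only intersects the congruences containing F x {1};
   [Theta_least] shows that this is the least congruence collapsing F. *)
Definition Theta (F : set L) : set (L * L) :=
  smallest is_congruence (F `*` [set \top]).

Lemma Theta_least (F : set L) :
  [/\ is_congruence (Theta F), collapses (Theta F) F &
      forall th, is_congruence th -> collapses th F -> Theta F `<=` th].
Proof.
split.
- split.
  + by move=> x th [/cong_refl + _]; apply.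
  + by move=> x y xy th thF; apply: (cong_sym thF.1); exact: xy.
  + move=> x y z xy yz th thF.
    by apply: (cong_trans thF.1 (y := y)); [exact: xy|exact: yz].
  + move=> x y x' y' xy xy' th thF.
    by apply: (cong_meet thF.1); [exact: xy|exact: xy'].
  + move=> x y x' y' xy xy' th thF.
    by apply: (cong_join thF.1); [exact: xy|exact: xy'].
  + by move=> x y xy th thF; apply: (cong_delta thF.1); exact: xy.
  + by move=> x y xy th thF; apply: (cong_nabla thF.1); exact: xy.
- by move=> x Fx; apply: sub_gen_smallest.
- move=> th cth thF; apply: smallest_sub => //.
  by move=> [x _] [/= Fx ->]; exact: thF.
Qed.

End WDLatticeTheory.

(* Main.v *)
Require Import Defs.
From HB Require Import structures.
From mathcomp Require Import all_boot all_order.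
From mathcomp Require Import boolp classical_sets.

(** Call the set of elements congruent to [\top] the kernel of a congruence.
    In a distributive lattice, a filter [K] yields the lattice congruence that
    identifies [x] and [y] when [x `&` f = y `&` f] for some [f] in [K].  Two
    congruences of this form always commute ([filter_rels_commute]): if
    [x `&` f = y `&` f] and [y `&` g = z `&` g], then
    [(x `&` g) `|` (z `&` f)] is a middle element for the other order of
    composition.  It remains to see that [Theta F] has this form.

    In a weakly dicomplemented lattice, the kernel [K] of a congruence is a
    filter closed under [f |-> wnabla (wdelta f)], because this map fixes
    [\top].  That closure makes the relation induced by [K] compatible with
    both weak complementations ([is_congruence_filter_rel]):
    [wnabla (wdelta f)] is disjoint from [wdelta f], which is the error term
    that appears when [wdelta] is applied to [x `&` f], and which bounds how
    far [x] is from lying below [y].  So the relation induced by the kernel of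
    [Theta F] is a congruence collapsing [F]; by minimality it contains
    [Theta F], and it is contained in any congruence with that kernel
    ([Theta_eq_filter_rel]). *)

Set Implicit Arguments.
Unset Strict Implicit.
Unset Printing Implicit Defensive.

Import Order.TTheory.
Local Open Scope classical_set_scope.
Local Open Scope order_scope.
Local Open Scope relation_scope.

Section WeakComplements.
Context {d : Order.disp_t} {L : wdLatticeType d}.
Implicit Types x y z : L.

Lemma joinx_wdelta x : x `|` wdelta x = \top.
Proof. by rewrite -[RHS](wdelta_split \top x) !meet1x. Qed.

Lemma meetx_wnabla x : x `&` wnabla x = \bot.
Proof. by rewrite -[RHS](wnabla_split \bot x) !join0x. Qed.

Lemma wdelta0 : wdelta \bot = \top :> L.
Proof. by rewrite -[LHS]join0x joinx_wdelta. Qed.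

Lemma wdelta1 : wdelta \top = \bot :> L.
Proof. by apply/eqP; rewrite -lex0 -wdelta0 wdeltaK_le. Qed.

Lemma wnabla0 : wnabla \bot = \top :> L.
Proof.
apply/eqP; rewrite -le1x; apply: le_trans (wnablaK_ge _) _.
by apply: wnabla_anti; exact: le0x.
Qed.

Lemma wdelta_adj x y : wdelta x <= y -> wdelta y <= x.
Proof. by move=> /wdelta_anti xy; apply: le_trans xy (wdeltaK_le x). Qed.

Lemma wnabla_adj x y : x <= wnabla y -> y <= wnabla x.
Proof. by move=> /wnabla_anti xy; apply: le_trans (wnablaK_ge y) xy. Qed.

(** [wdelta] is an antitone Galois connection with itself, hence it turns
    meets into joins. *)
Lemma wdelta_meet x y : wdelta (x `&` y) = wdelta x `|` wdelta y.
Proof.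
apply: le_anti; apply/andP; split.
  by apply: wdelta_adj; rewrite lexI; apply/andP; split; apply: wdelta_adj;
    [exact: leUl|exact: leUr].
by rewrite leUx !wdelta_anti // ?leIl ?leIr.
Qed.

(** Dually, the self-adjointness of [wnabla] turns joins into meets. *)
Lemma wnabla_join x y : wnabla (x `|` y) = wnabla x `&` wnabla y.
Proof.
apply: le_anti; apply/andP; split.
  by rewrite lexI !wnabla_anti // ?leUl ?leUr.
by apply: wnabla_adj; rewrite leUx; apply/andP; split; apply: wnabla_adj;
  [exact: leIl|exact: leIr].
Qed.

End WeakComplements.

(** The lattice congruence with kernel [K], when [K] is a filter of a
    distributive lattice. *)
Definition filter_rel d (L : distrWDLatticeType d) (K : set L) : set (L * L) :=
  [set p | exists2 f, K f & p.1 `&` f = p.2 `&` f].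

Section Congruences.
Context {d : Order.disp_t} {L : distrWDLatticeType d}.
Implicit Types (x y z f g : L) (K : set L) (th : set (L * L)).

Definition kernel th : set L := [set x | th (x, \top)].

Lemma is_filter_kernel th : is_congruence th -> is_filter (kernel th).
Proof.
move=> cth; split.
- by exists \top; exact: cong_refl cth _.
- move=> x y thx /join_r xy; rewrite /kernel /=.
  by have := cong_join cth thx (cong_refl cth y); rewrite xy join1x.
- move=> x y thx thy; rewrite /kernel /=.
  by have := cong_meet cth thx thy; rewrite meet1x.
Qed.

Lemma kernel_wnabla_wdelta th f :
  is_congruence th -> kernel th f -> kernel th (wnabla (wdelta f)).
Proof.
move=> cth /(cong_delta cth)/(cong_nabla cth).
by rewrite wdelta1 wnabla0.
Qed.

Lemma filter_rel_sub th :
  is_congruence th -> filter_rel (kernel th) `<=` th.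
Proof.
move=> cth [x y] [f thf /= xy].
have meetf z : th (z `&` f, z).
  by have := cong_meet cth (cong_refl cth z) thf; rewrite meetx1.
apply: (cong_trans cth (cong_sym cth (meetf x))).
by rewrite xy; exact: meetf.
Qed.

Lemma filter_rel_wdelta x y f : x `&` f = y `&` f ->
  wdelta x `&` wnabla (wdelta f) = wdelta y `&` wnabla (wdelta f).
Proof.
move=> xy.
have cut z : wdelta z `&` wnabla (wdelta f) =
             wdelta (z `&` f) `&` wnabla (wdelta f).
  by rewrite wdelta_meet meetUl meetx_wnabla joinx0.
by rewrite cut xy -cut.
Qed.

(** Since [f] and [wdelta f] cover the lattice, agreement below [f] gives
    [y <= x `|` wdelta f]; [wnabla] turns this join into a meet. *)
Lemma filter_rel_wnabla_le x y f : x `&` f = y `&` f ->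
  wnabla x `&` wnabla (wdelta f) <= wnabla y.
Proof.
move=> xy; rewrite -wnabla_join; apply: wnabla_anti.
rewrite -[y]meetx1 -(joinx_wdelta f) meetUr -xy.
by apply: leU2; [exact: leIl|exact: leIr].
Qed.

Lemma filter_rel_wnabla x y f : x `&` f = y `&` f ->
  wnabla x `&` wnabla (wdelta f) = wnabla y `&` wnabla (wdelta f).
Proof.
move=> xy; apply: le_anti; apply/andP.
by split; rewrite lexI leIr andbT; exact: filter_rel_wnabla_le.
Qed.

(** Distributivity gives compatibility with the lattice operations; closure
    of [K] under [wnabla \o wdelta] supplies the witnesses for the two weak
    complementations. *)
Lemma is_congruence_filter_rel K : is_filter K ->
  (forall f, K f -> K (wnabla (wdelta f))) -> is_congruence (filter_rel K).
Proof.
move=> [[k Kk] _ KI] Knd.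
split.
- by move=> x; exists k.
- by move=> x y [f Kf /= xy]; exists f.
- move=> x y z [f Kf /= xy] [g Kg /= yz]; exists (f `&` g); first exact: KI.
  by rewrite /= !meetA xy meetAC yz meetAC.
- move=> x y x' y' [f Kf /= xy] [g Kg /= xy']; exists (f `&` g); first exact: KI.
  by rewrite /= ![_ `&` (f `&` g)]meetACA xy xy'.
- move=> x y x' y' [f Kf /= xy] [g Kg /= xy']; exists (f `&` g); first exact: KI.
  rewrite /= !meetUl ![_ `&` (f `&` g)]meetA xy; congr (_ `|` _).
  by rewrite meetAC xy' meetAC.
- move=> x y [f Kf /= xy]; exists (wnabla (wdelta f)); first exact: Knd.
  exact: filter_rel_wdelta.
- move=> x y [f Kf /= xy]; exists (wnabla (wdelta f)); first exact: Knd.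
  exact: filter_rel_wnabla.
Qed.

(** The kernel of [Theta F] is used in place of an explicit description of the
    filter generated by iterating [wnabla \o wdelta] on [F]. *)
Lemma Theta_eq_filter_rel (F : set L) :
  Theta F = filter_rel (kernel (Theta F)).
Proof.
have [cT TF Tmin] := Theta_least F.
apply/seteqP; split; last exact: filter_rel_sub.
apply: Tmin.
  apply: is_congruence_filter_rel; first exact: is_filter_kernel.
  by move=> f; exact: kernel_wnabla_wdelta.
by move=> x Fx; exists x; [exact: TF|rewrite /= meetxx meet1x].
Qed.

Lemma filter_rels_commute_sub (K1 K2 : set L) :
  filter_rel K1 \; filter_rel K2 `<=` filter_rel K2 \; filter_rel K1.
Proof.
move=> [x z] [y [f K1f /= xy] [g K2g /= yz]].
have xz : x `&` f `&` g = z `&` f `&` g by rewrite xy meetAC yz meetAC.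
(* The middle element must restrict to [x] below [g] and to [z] below [f];
   joining these two pieces works because they agree below [f `&` g]. *)
exists ((x `&` g) `|` (z `&` f)).
- exists g => //=.
  by rewrite meetUl -meetA meetxx -xz join_l // meetAC leIl.
- exists f => //=.
  by rewrite meetUl meetAC xz -[z `&` f `&` f]meetA meetxx join_r // leIl.
Qed.

Lemma filter_rels_commute (K1 K2 : set L) :
  filter_rel K1 \; filter_rel K2 = filter_rel K2 \; filter_rel K1.
Proof. by apply/seteqP; split; exact: filter_rels_commute_sub. Qed.

End Congruences.

Theorem theorem17 (d : Order.disp_t) (L : distrWDLatticeType d)
    (F1 F2 : set L) (hF1 : is_filter F1) (hF2 : is_filter F2) :
  Theta F1 \; Theta F2 = Theta F2 \; Theta F1.
Proof.
by rewrite (Theta_eq_filter_rel F1) (Theta_eq_filter_rel F2) filter_rels_commute.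
Qed.
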